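(* Let $L\in\mathbb{N}$ and let $\langle u_n\rangle_{n=1}^{\infty}$ be a sequence of real numbers. (a) If $\langle u_n\rangle_{n=1}^{\infty}$ is periodic with period $L$, then there exist $\ell\in\mathbb{N}$ with $\ell\le L$ and constant subsequences $\langle v^{i}_k\rangle_{k=0}^{\infty}$ ($i=1,\dots,\ell$) of $\langle u_n\rangle_{n=1}^{\infty}$ such that (i) if $i\ne j$, then $\langle v^{i}_k\rangle_{k=0}^{\infty}$ and $\langle v^{j}_k\rangle_{k=0}^{\infty}$ are distinct; and (ii) the merger of $\langle v^{1}_k\rangle_{k=0}^{\infty},\dots,\langle v^{\ell}_k\rangle_{k=0}^{\infty}$ is $\langle u_n\rangle_{n=1}^{\infty}$, i.e. the index sets in $\mathbb{N}$ along which these $\ell$ subsequences are taken form a partition of $\mathbb{N}$. (b) Conversely, suppose $\langle u_n\rangle_{n=1}^{\infty}$ has $L$ constant subsequences $\langle v^{i}_k\rangle_{k=0}^{\infty}$ ($i\in\{1,\dots,L\}$) such that (i) if $i\ne j$, then $\langle v^{i}_k\rangle_{k=0}^{\infty}$ and $\langle v^{j}_k\rangle_{k=0}^{\infty}$ are distinct; and (ii) the ordered merger of these $L$ subsequences is $\langle u_n\rangle_{n=1}^{\infty}$, i.e. $u_{i+kL}=v^{i}_k$ for all $i\in\{1,\dots,L\}$ and all integers $k\ge 0$. Then $\langle u_n\rangle_{n=1}^{\infty}$ is periodic with period $L$.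
   Context: $\mathbb{N}=\{1,2,3,\dots\}$. A sequence $\langle u_n\rangle_{n=1}^{\infty}$ is periodic with period $L$ if $u_{i+kL}=u_i$ for all $i\in\mathbb{N}$ and $k\in\mathbb{Z}$ with $i+kL\in\mathbb{N}$ (the period is not required to be minimal). Two sequences are called distinct if they have no element (value) in common. *)

(* Defs.v *)
From mathcomp Require Import all_boot all_order all_algebra.
From mathcomp Require Import boolp classical_sets reals.

Set Implicit Arguments.
Unset Strict Implicit.
Unset Printing Implicit Defensive.

Local Open Scope classical_set_scope.

(* A sequence <u_n> with n = 1, 2, ... is a function u : nat -> R whose value
   at 0 is irrelevant: every definition below only inspects u at positive
   indices.  Subsequences <v_k> are indexed by k = 0, 1, 2, ... *)

Definition periodic_with (T : Type) (L : nat) (u : nat -> T) : Prop :=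
  forall (i j : nat) (k : int), (0 < i)%N -> (0 < j)%N ->
    (Posz j = Posz i + k * Posz L)%R -> u j = u i.

Definition subsequence_along (T : Type) (u : nat -> T) (s : nat -> nat)
    (v : nat -> T) : Prop :=
  [/\ forall k, (0 < s k)%N,
      {homo s : k m / (k < m)%N} &
      forall k, v k = u (s k)].

Definition subsequence (T : Type) (u v : nat -> T) : Prop :=
  exists s : nat -> nat, subsequence_along u s v.

Definition constant_sequence (T : Type) (v : nat -> T) : Prop :=
  exists c : T, forall k, v k = c.

(* "Distinct" means having no value in common, not merely being different. *)
Definition distinct_sequences (T : Type) (v w : nat -> T) : Prop :=
  forall k m : nat, v k <> w m.

(* u is the merger of the v i, taken as subsequences of u along the s i. *)
Definition merger_along (T : Type) (l : nat) (u : nat -> T)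
    (s : 'I_l -> nat -> nat) (v : 'I_l -> nat -> T) : Prop :=
  (forall i, subsequence_along u (s i) (v i)) /\
  classical_sets.partition [set: 'I_l] (fun i => range (s i))
    [set n : nat | (0 < n)%N].

(* The ordinal i : 'I_L stands for the index i + 1 in {1, ..., L}. *)
Definition ordered_merger (T : Type) (L : nat) (u : nat -> T)
    (v : 'I_L -> nat -> T) : Prop :=
  forall (i : 'I_L) (k : nat), u (i.+1 + k * L)%N = v i k.

(* Main.v *)
(** For (a), take one subsequence per value of u: there are at most L values
    u_1, ..., u_L, and by periodicity each value is taken at infinitely many
    indices, so its level set can be enumerated increasingly. The level sets
    partition the positive integers. For (b), u_n depends only on the residue
    of n modulo L. *)

Require Import Defs.
From mathcomp Require Import all_boot all_order all_algebra.
From mathcomp Require Import boolp classical_sets reals.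

Set Implicit Arguments.
Unset Strict Implicit.
Unset Printing Implicit Defensive.

Local Open Scope classical_set_scope.

(** A negative shift taking [i] to [j] is a positive shift taking [j] to [i], so natural multiples
    of [L] suffice. *)
Lemma periodic_withP (T : Type) (L : nat) (u : nat -> T) :
  periodic_with L u <->
  forall i m : nat, (0 < i)%N -> u (i + m * L)%N = u i.
Proof.
split=> [uP i m i0|uP i j k i0 j0 jE].
  by apply: (uP _ _ (Posz m)) => //; rewrite addn_gt0 i0.
case: k jE => m jE.
  have -> : j = (i + m * L)%N by apply/eqP; rewrite -eqz_nat jE PoszD PoszM.
  exact: uP.
have -> : i = (j + m.+1 * L)%N.
  apply/eqP; rewrite -eqz_nat PoszD PoszM jE NegzE.
  by rewrite -GRing.addrA GRing.mulNr GRing.addNr GRing.addr0.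
by rewrite uP.
Qed.

(** Greedy enumeration: each term is the least element of [P] beyond the previous one, which exists
    because [P] is unbounded. *)
Lemma increasing_enumeration (P : pred nat) :
  (forall n, exists m, (n <= m)%N && P m) ->
  exists s : nat -> nat, {homo s : k m / (k < m)%N} /\ range s = [set n | P n].
Proof.
move=> Pinf.
pose next n := ex_minn (Pinf n).
have next_ge n : (n <= next n)%N by rewrite /next; case: ex_minnP => m /andP[].
have nextP n : P (next n) by rewrite /next; case: ex_minnP => m /andP[].
have next_min n m : (n <= m)%N -> P m -> (next n <= m)%N.
  by rewrite /next; case: ex_minnP => p _ pmin nm Pm; rewrite pmin ?nm.
pose s := fix s k := if k is k'.+1 then next (s k').+1 else next 0%N.
have sS k : (s k < s k.+1)%N by exact: next_ge.
have s_ge k : (k <= s k)%N by elim: k => // k /leq_ltn_trans; apply.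
exists s; split; first exact: (homo_ltn ltn_trans sS).
apply/seteqP; split=> [_ [[|k] _ <-]|n /= Pn]; [exact: nextP..|].
have ex_s : exists k, (n <= s k)%N by exists n.
(* For the least [k] with [n <= s k], any preceding term is below [n], so the greedy choice of [s k]
   cannot overshoot [n]. *)
case: (ex_minnP ex_s) => k n_le kmin; exists k => //.
apply/eqP; rewrite eqn_leq n_le andbT.
case: k n_le kmin => [|k] _ kmin; apply: next_min => //.
by rewrite ltnNge; apply/negP => /kmin; rewrite ltnn.
Qed.

Theorem theorem5p2 (R : realType) (L : nat) (hL : (0 < L)%N) (u : nat -> R) :
  (periodic_with L u ->
    exists (l : nat) (s : 'I_l -> nat -> nat) (v : 'I_l -> nat -> R),
      (0 < l)%N /\ (l <= L)%N /\
      (forall i : 'I_l, subsequence u (v i) /\ constant_sequence (v i)) /\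
      (forall i j : 'I_l, i <> j -> distinct_sequences (v i) (v j)) /\
      merger_along u s v)
  /\
  (forall v : 'I_L -> nat -> R,
      (forall i : 'I_L, subsequence u (v i) /\ constant_sequence (v i)) ->
      (forall i j : 'I_L, i <> j -> distinct_sequences (v i) (v j)) ->
      ordered_merger u v ->
      periodic_with L u).
Proof.
split=> [/periodic_withP uP|v vP _ uv]; last first.
  apply/periodic_withP => -[//|i] m _.
  (* Indices of [u] start at 1 and ordinals at 0, so the division by [L] is applied to the
     predecessor of the index. *)
  have uE n : u n.+1 = v (Ordinal (ltn_pmod n hL)) (n %/ L)%N.
    by rewrite -uv /= addSn addnC -divn_eq.
  have [_ [c vc]] := vP (Ordinal (ltn_pmod i hL)).
  have same_residue :
      Ordinal (ltn_pmod (i + m * L) hL) = Ordinal (ltn_pmod i hL).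
    by apply: val_inj; rewrite /= addnC modnMDl.
  by rewrite addSn !uE same_residue !vc.
(* The distinct values among the first [L] terms; their number is the required [l]. The default
   [u 0] below is never reached. *)
pose vals := undup [seq u i.+1 | i <- iota 0 L].
pose val (i : 'I_(size vals)) := nth (u 0%N) vals i.
have valI i j : val i = val j -> i = j.
  by move=> /eqP; rewrite nth_uniq ?undup_uniq // => /eqP /ord_inj.
have u_val n : (0 < n)%N -> exists i, u n = val i.
  case: n => // n _.
  have un : u n.+1 \in vals.
    rewrite mem_undup {1}(divn_eq n L) addnC -addSn uP //.
    by apply/mapP; exists (n %% L)%N; rewrite // mem_iota add0n ltn_mod.
  have lt_i : (index (u n.+1) vals < size vals)%N by rewrite index_mem.
  by exists (Ordinal lt_i); rewrite /val nth_index.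
have val_u i n : exists m, (n <= m)%N && ((0 < m)%N && (u m == val i)).
  have : val i \in vals by rewrite mem_nth.
  rewrite mem_undup => /mapP[r _ ->].
  (* Shifting the index [r.+1] by [n] periods keeps the value and passes [n], since [L] is at least
     1. *)
  exists (r.+1 + n * L)%N; rewrite uP // eqxx addn_gt0 /= andbT.
  by rewrite (leq_trans (leq_pmulr n hL)) ?leq_addl.
have [s sP] := choice (fun i => increasing_enumeration (val_u i)).
have s_val i k : (0 < s i k)%N /\ u (s i k) = val i.
  have [_ sE] := sP i.
  have : range (s i) (s i k) by exists k.
  by rewrite sE /= => /andP[-> /eqP].
have s_sub i : subsequence_along u (s i) (fun=> val i).
  split=> [k||k]; [by have [] := s_val i k|by have [] := sP i|].
  by have [] := s_val i k.
exists (size vals), s, (fun i _ => val i); split.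
  (* The first term already has a value, so [vals] is nonempty. *)
  by have [i _] := u_val 1%N isT; exact: leq_ltn_trans (ltn_ord i).
split; first by rewrite (leq_trans (size_undup _)) // size_map size_iota.
split; first by move=> i; split; [exists (s i) | exists (val i)].
split; first by move=> i j ij _ _ /valI.
split=> //; split.
- apply/seteqP; split=> [n [i _ [k _ <-]]|n n0] /=; first by have [] := s_val i k.
  have [i un] := u_val n n0; exists i => //.
  by have [_ ->] := sP i; rewrite /= un eqxx andbT.
(* At an index common to two ranges, [u] equals both [val i] and [val j]. *)
- move=> i j _ _ [_ [[k _ <-] [m _ sE]]]; apply: valI.
  by have [_ <-] := s_val i k; have [_ <-] := s_val j m; rewrite sE.
- by move=> i _; exists (s i 0%N), 0%N.
Qed.
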